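(* Let $\sigma>1$ be a constant and let $\Sigma\in\mathbb R^{k\times k}$ be a fixed diagonal covariance matrix with diagonal entries $\sigma_j^2$ satisfying $0<\sigma_j^2\le\sigma^2$ for all $j$. Let $\mathcal P=\{\mathcal N(\mu,\Sigma):\mu\in[0,1]^k\}$. Then there exists a parametric class of events $\mathcal E(\cdot)$ for $\mathcal P$ such that for any $\gamma>0$ and any two distributions $P,Q\in\mathcal P$ with $\mathrm{KL}(P\|Q)\ge\gamma$, the class $\mathcal E(\gamma)$ contains an event $E$ that is $\xi$-distinguishing for $P$ and $Q$, where $\max\{1/\xi,|\mathcal E(\gamma)|\}\le\mathrm{poly}(k,1/\gamma)$.
   Context: An event $E\subseteq\mathbb R^k$ is $\xi$-distinguishing for distributions $P,Q$ if $|P(E)-Q(E)|\ge\xi$, where $P(E)=\Pr_{y\sim P}[y\in E]$. A parametric class of events is a map assigning to each $\gamma>0$ a set $\mathcal E(\gamma)$ of events. *)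

(* Defs.v *)
From HB Require Import structures.
From mathcomp Require Import all_boot all_order all_algebra.
From mathcomp Require Import all_classical all_reals all_analysis.

Set Implicit Arguments.
Unset Strict Implicit.
Unset Printing Implicit Defensive.

Import Order.TTheory GRing.Theory Num.Theory.
Import numFieldNormedType.Exports.

Local Open Scope classical_set_scope.
Local Open Scope ring_scope.

(* R^k as a measurable space: k.-tuples carry the product sigma-algebra, and
   [measurableTypeR R] is R with its Borel sigma-algebra, the type over which
   [lebesgue_measure] is defined. *)
Notation "''Rn[' R ]_ k" := (k.-tuple (measurableTypeR R))
  (at level 8, k at level 2, format "''Rn[' R ]_ k") : type_scope.

Section lebesgue_tuple.
Variables (R : realType) (k : nat).

Definition cons_coord (z : 'Rn[R]_k * measurableTypeR R) : 'Rn[R]_k.+1 :=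
  [the k.+1.-tuple (measurableTypeR R) of z.2 :: z.1].

Lemma measurable_cons_coord : measurable_fun setT cons_coord.
Proof. exact: measurable_cons. Qed.

Variable m : {measure set 'Rn[R]_k -> \bar R}.

(* The new coordinate is the second factor of the product because
   [product_measure1] is a measure as soon as its second factor is
   sigma-finite. *)
Definition lebesgue_step : set 'Rn[R]_k.+1 -> \bar R :=
  pushforward (m \x @lebesgue_measure R)%E cons_coord.

Let mx : {measure set ('Rn[R]_k * measurableTypeR R) -> \bar R} :=
  [the measure _ _ of (m \x @lebesgue_measure R)%E].

Let step0 : lebesgue_step set0 = 0%E.
Proof. by rewrite /lebesgue_step /pushforward preimage_set0 (measure0 mx). Qed.

Let step_ge0 A : (0 <= lebesgue_step A)%E.
Proof. exact: (measure_ge0 mx). Qed.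

Let step_sigma_additive : semi_sigma_additive lebesgue_step.
Proof.
have := @measure_semi_sigma_additive _ _ _ (pushforward mx cons_coord).
by apply; exact: measurable_cons_coord.
Qed.

HB.instance Definition _ :=
  isMeasure.Build _ _ _ lebesgue_step step0 step_ge0 step_sigma_additive.

End lebesgue_tuple.

(* k-dimensional Lebesgue measure *)
Fixpoint lebesgue_tuple (R : realType) (k : nat) :
    {measure set 'Rn[R]_k -> \bar R} :=
  match k with
  | 0 => [the measure _ _ of dirac [tuple]]
  | k'.+1 => [the measure _ _ of lebesgue_step (lebesgue_tuple R k')]
  end.

Definition row_of_tuple (R : realType) (k : nat) (y : 'Rn[R]_k) : 'rV[R]_k :=
  \row_j tnth y j.

Definition mvnormal_pdf (R : realType) (k : nat) (mu : 'rV[R]_k)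
    (Sigma : 'M[R]_k) (y : 'Rn[R]_k) : R :=
  let z := row_of_tuple y - mu in
  (Num.sqrt ((2 * pi) ^+ k * \det Sigma))^-1 *
  expR (- (2^-1 * (z *m invmx Sigma *m z^T) 0 0)).

(* P = N(mu, Sigma), for an invertible covariance matrix Sigma *)
Definition is_mvnormal (R : realType) (k : nat) (mu : 'rV[R]_k)
    (Sigma : 'M[R]_k) (P : probability 'Rn[R]_k R) : Prop :=
  forall A : set 'Rn[R]_k, measurable A ->
    P A = (\int[lebesgue_tuple R k]_(y in A) (mvnormal_pdf mu Sigma y)%:E)%E.

Definition gaussian_class (R : realType) (k : nat) (Sigma : 'M[R]_k) :
    set (probability 'Rn[R]_k R) :=
  [set P | exists2 mu : 'rV[R]_k,
    forall j, 0 <= mu 0 j <= 1 & is_mvnormal mu Sigma P].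

(* Since [ln] is 0 on nonpositive reals, the integrand is the logarithm of
   dP/dQ outside the P-null set where dP/dQ <= 0. *)
Definition KL (R : realType) (d : measure_display) (T : measurableType d)
    (P Q : probability T R) : \bar R :=
  if `[< P `<< Q >] then
    (\int[P]_x (ln (fine (Radon_Nikodym (charge_of_finite_measure P) Q x)))%:E)%E
  else +oo%E.

Definition distinguishing (R : realType) (d : measure_display)
    (T : measurableType d) (xi : R) (P Q : probability T R) (A : set T) : Prop :=
  (xi%:E <= `|P A - Q A|)%E.

Definition is_event_class (R : realType) (d : measure_display)
    (T : measurableType d) (E : R -> set (set T)) : Prop :=
  forall gamma, 0 < gamma -> E gamma `<=` measurable.

(* The smallest diagonal entry of Sigma, capped by [bound]. *)
Definition min_variance (R : realType) (k : nat) (bound : R)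
    (Sigma : 'M[R]_k) : R :=
  \big[Num.min/bound]_(j < k) Sigma j j.

(* Main.v *)
Require Import Defs.
From HB Require Import structures.
From mathcomp Require Import all_boot all_order all_algebra.
From mathcomp Require Import all_classical all_reals all_analysis.
From mathcomp Require Import measurable_realfun ring lra.

Set Implicit Arguments.
Unset Strict Implicit.
Unset Printing Implicit Defensive.

Import Order.TTheory GRing.Theory Num.Theory.
Import numFieldNormedType.Exports.

Local Open Scope classical_set_scope.
Local Open Scope ring_scope.

(* The events are the k half-spaces {y_j <= 0}, whatever gamma is. Write D for
   the difference of the two means and s_j^2 = Sigma_jj. The log-likelihood
   ratio is affine in y, so bounding its absolute value and using a first moment
   bound for one-dimensional normal laws gives
     KL P Q <= sum_j |D_j| (4 s_j + |D_j|) / (2 s_j^2),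
   which forces |D_j| >= const * gamma / (k + 1) for some j. For this j, both
   P and Q give {y_j <= 0} the mass that a centered normal law puts on a
   half-line; these half-lines differ by an interval of length |D_j| contained
   in [-1, 0], where the density is bounded below. *)

(** * Integration against a measure given by a density *)

Section integral_density.
Local Open Scope ereal_scope.
Context d (T : measurableType d) (R : realType).
Variables (m P : {measure set T -> \bar R}) (h : T -> R).
Hypothesis mh : measurable_fun setT h.
Hypothesis h0 : forall x, (0 <= h x)%R.
Hypothesis Ph : forall A, measurable A -> P A = \int[m]_(x in A) (h x)%:E.

Import HBNNSimple.

(** A simple function is a finite combination of indicators of its level sets, and on each level set
    the identity is [Ph]. *)
Let integral_density_nnsfun (g : {nnsfun T >-> R}) :
  \int[P]_x (g x)%:E = \int[m]_x ((g x)%:E * (h x)%:E).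
Proof.
have mi r : measurable (g @^-1` [set r]) by exact: measurable_funPTI.
have mgi r : measurable_fun [set: T] (fun x => (r * \1_(g @^-1` [set r]) x)%:E : \bar R).
  exact/measurable_EFinP/measurable_funM.
have gi0 r x : 0 <= (r * \1_(g @^-1` [set r]) x)%:E.
  exact: nnfun_muleindic_ge0.
under eq_integral do rewrite fimfunE -fsumEFin//.
rewrite ge0_integral_fsum//.
under [RHS]eq_integral do rewrite fimfunE -fsumEFin// ge0_mule_fsuml//.
rewrite ge0_integral_fsum//; last 2 first.
- by move=> r; apply: emeasurable_funM => //; exact/measurable_EFinP.
- by move=> r x _; rewrite mule_ge0// lee_fin.
apply: eq_fsbigr => r; rewrite inE => -[t _ <-].
rewrite integralZl_indic_nnsfun// integral_indic// setIT Ph//.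
under [RHS]eq_integral do rewrite EFinM -muleA.
rewrite ge0_integralZl//; last 3 first.
- by apply: emeasurable_funM; exact/measurable_EFinP.
- by move=> x _; rewrite mule_ge0// lee_fin.
- by rewrite lee_fin.
congr (_ * _); rewrite integral_mkcond; apply: eq_integral => x _.
by rewrite patchE indicE; case: ifPn => _; rewrite ?mul1e ?mul0e.
Qed.

(** Monotone convergence extends the simple case: the approximations increase to [f], and
    multiplying them by [h >= 0] keeps them increasing. *)
Lemma integral_density (f : T -> \bar R) :
  measurable_fun setT f -> (forall x, 0 <= f x) ->
  \int[P]_x f x = \int[m]_x (f x * (h x)%:E).
Proof.
move=> mf f0; pose g := nnsfun_approx measurableT mf.
have gf x : (g n x)%:E @[n --> \oo] --> f x.
  by apply: cvg_nnsfun_approx => // t _; exact: f0.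
have -> : \int[P]_x f x = limn (fun n => \int[P]_x (g n x)%:E).
  rewrite -monotone_convergence//.
  - by apply: eq_integral => x _; exact/esym/cvg_lim.
  - by move=> n; exact/measurable_EFinP.
  - by move=> n x _; rewrite lee_fin.
  - by move=> x _ a b ab; rewrite lee_fin; exact/lefP/nd_nnsfun_approx.
have -> : \int[m]_x (f x * (h x)%:E) =
    limn (fun n => \int[m]_x ((g n x)%:E * (h x)%:E)).
  rewrite -monotone_convergence//.
  - by apply: eq_integral => x _; apply/esym/cvg_lim => //; exact: cvgeZr.
  - by move=> n; apply: emeasurable_funM; exact/measurable_EFinP.
  - by move=> n x _; rewrite mule_ge0// lee_fin.
  - move=> x _ a b ab; rewrite lee_wpmul2r ?lee_fin//.
    exact/lefP/nd_nnsfun_approx.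
by congr (limn _); apply/funext => n; exact: integral_density_nnsfun.
Qed.

End integral_density.

(** * Sigma-finiteness and Tonelli for Lebesgue measure on tuples *)

(* [fubini_tonelli1] wants bundled sigma-finite measures, but [lebesgue_tuple R k]
   is only bundled as a measure. *)
Section sigma_finite_factor.
Local Open Scope ereal_scope.
Context d1 d2 (T1 : measurableType d1) (T2 : measurableType d2) (R : realType).
Variables (m1 : {measure set T1 -> \bar R}).
Variables (m2 : {sigma_finite_measure set T2 -> \bar R}).
Hypothesis sf1 : sigma_finite setT m1.

Lemma integral_product_measure1 (f : T1 * T2 -> \bar R) :
  measurable_fun setT f -> (forall z, 0 <= f z) ->
  \int[m1 \x m2]_z f z = \int[m1]_x \int[m2]_y f (x, y).
Proof.
pose Hsigma := isSigmaFinite.Build _ _ _ _ sf1.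
pose Hsfin := isSFinite.Build _ _ _ _ (sfinite_measure_sigma_finite sf1).
pose m := HB.pack_for {sigma_finite_measure set T1 -> \bar R}
  (Measure.sort m1) Hsigma Hsfin.
exact: (@fubini_tonelli1 _ _ _ _ _ m m2).
Qed.

End sigma_finite_factor.

(** By induction on [k], products of exhausting sets of the two factors, carried over by the inverse
    [c] of [cons_coord], exhaust the next space. *)
Lemma sigma_finite_lebesgue_tuple (R : realType) (k : nat) :
  sigma_finite setT (lebesgue_tuple R k).
Proof.
elim: k => [|k IH].
  exact: (sigma_finiteT (dirac ([tuple] : 'Rn[R]_0))).
have /sigma_finiteP[F [FT ndF Foo]] := IH.
have /sigma_finiteP[G [GT ndG Goo]] := sigma_finiteT (@lebesgue_measure R).
pose c (y : 'Rn[R]_k.+1) : 'Rn[R]_k * measurableTypeR R :=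
  ([tuple of behead y], thead y).
have mc : measurable_fun setT c.
  apply/measurable_fun_pair; first exact: measurable_behead.
  exact: measurable_tnth.
have cK : cancel (@cons_coord R k) c.
  by case=> y x; congr pair; exact/val_inj.
exists (fun n => c @^-1` (F n `*` G n)).
  apply/esym; rewrite -subTset => y _.
  have [i _ Fi] : (\bigcup_n F n) (c y).1 by rewrite -FT.
  have [j _ Gj] : (\bigcup_n G n) (c y).2 by rewrite -GT.
  (* Both exhaustions are increasing, so one index serves the two factors at once. *)
  exists (maxn i j) => //; split.
    by move: Fi; exact/subsetPset/ndF/leq_maxl.
  by move: Gj; exact/subsetPset/ndG/leq_maxr.
move=> n; have [mF Foon] := Foo n; have [mG Goon] := Goo n; split.
  by rewrite -[X in measurable X]setTI; apply: mc => //; exact: measurableX.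
rewrite /= /lebesgue_step /pushforward.
rewrite [X in product_measure1 _ _ X](_ : _ = F n `*` G n); last first.
  by apply/seteqP; split => z; rewrite /preimage /mkset cK.
by rewrite product_measure1E// lte_mul_pinfty// ge0_fin_numE.
Qed.

(** Induction on [k]: undoing the pushforward by [cons_coord] and applying Tonelli splits off
    coordinate 0, whose integral is constant in the other coordinates. *)
Lemma integral_lebesgue_tuple_prod (R : realType) (k : nat) (f : 'I_k -> R -> R) :
  (forall j, measurable_fun setT (f j)) -> (forall j x, 0 <= f j x) ->
  (\int[lebesgue_tuple R k]_y (\prod_(j < k) f j (tnth y j))%:E =
   \prod_(j < k) \int[lebesgue_measure]_x (f j x)%:E)%E.
Proof.
elim: k f => [|k IH] f mf f0.
  rewrite big_ord0; under eq_integral do rewrite big_ord0.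
  by rewrite integral_cst// mul1e /= diracT.
have mprod (n : nat) (g : 'I_n -> R -> R) :
    (forall j, measurable_fun setT (g j)) ->
    measurable_fun setT
      (fun y : 'Rn[R]_n => (\prod_(j < n) g j (tnth y j))%:E : \bar R).
  move=> mg; apply/measurable_EFinP/measurable_prod => j _.
  exact: measurableT_comp (mg j) (@measurable_tnth _ _ _ j).
pose mx : {measure set ('Rn[R]_k * measurableTypeR R) -> \bar R} :=
  [the measure _ _ of (lebesgue_tuple R k \x @lebesgue_measure R)%E].
have mc := @measurable_cons_coord R k.
transitivity (\int[pushforward mx (@cons_coord R k)]_y
    (\prod_(j < k.+1) f j (tnth y j))%:E)%E.
  by apply: eq_measure_integral.
rewrite (ge0_integral_pushforward mc)//=; last 2 first.
- exact: mprod.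
- by move=> y _; rewrite lee_fin prodr_ge0.
rewrite preimage_setT.
transitivity (\int[lebesgue_tuple R k]_y \int[lebesgue_measure]_x
    (\prod_(j < k.+1) f j (tnth (cons_coord (y, x)) j))%:E)%E.
  apply: (@integral_product_measure1 _ _ _ _ R (lebesgue_tuple R k)
    lebesgue_measure (@sigma_finite_lebesgue_tuple R k)
    (fun z => (\prod_(j < k.+1) f j (tnth (cons_coord z) j))%:E)).
    exact: (measurableT_comp (mprod _ _ mf) mc).
  by move=> y; rewrite lee_fin prodr_ge0.
rewrite big_ord_recl.
transitivity (\int[lebesgue_tuple R k]_y ((\prod_(j < k) f (lift ord0 j) (tnth y j))%:E *
   \int[lebesgue_measure]_x (f ord0 x)%:E))%E.
  apply: eq_integral => y _.
  rewrite -ge0_integralZl//; last 3 first.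
  - by apply/measurable_EFinP; exact: mf.
  - by move=> x _; rewrite lee_fin.
  - by rewrite lee_fin prodr_ge0.
  apply: eq_integral => x _.
  rewrite big_ord_recl /= tnth0 -EFinM mulrC; congr (_ * _)%:E.
  by apply: eq_bigr => j _; rewrite tnthS.
rewrite ge0_integralZr//; last 3 first.
- exact: (mprod _ (fun j => f (lift ord0 j))).
- by move=> y _; rewrite lee_fin prodr_ge0.
- by apply: integral_ge0 => x _; rewrite lee_fin.
by rewrite (IH (fun j => f (lift ord0 j)))// muleC.
Qed.

(** * Factorization of a Gaussian density with diagonal covariance *)

Lemma mvnormal_pdf_diag (R : realType) (k : nat) (mu : 'rV[R]_k) (Sigma : 'M[R]_k)
    (y : 'Rn[R]_k) :
  is_diag_mx Sigma -> (forall j, 0 < Sigma j j) ->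
  mvnormal_pdf mu Sigma y =
  \prod_(j < k) normal_pdf (mu 0 j) (Num.sqrt (Sigma j j)) (tnth y j).
Proof.
move=> /diag_mxP[v ->] v0; rewrite /mvnormal_pdf; set z := row_of_tuple y - mu; cbv zeta.
have vgt0 j : 0 < v 0 j by have := v0 j; rewrite mxE eqxx.
have uS : diag_mx v \in unitmx.
  by rewrite unitmxE det_diag unitfE; apply/prodf_neq0 => j _; rewrite gt_eqF.
have -> : invmx (diag_mx v) = diag_mx (\row_j (v 0 j)^-1).
  apply: (can_inj (mulKmx uS)); rewrite mulmxV// mulmx_diag.
  by apply/matrixP => i j; rewrite !mxE divff// lt0r_neq0.
have -> : (z *m diag_mx (\row_j (v 0 j)^-1) *m z^T) 0 0 = \sum_j z 0 j ^+ 2 / v 0 j.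
  rewrite mxE; apply: eq_bigr => j _.
  by rewrite mul_mx_diag !mxE mulrAC expr2.
rewrite det_diag mulr_sumr -sumrN expR_sum.
(* Writing [(2 * pi) ^+ k] as a product over the coordinates lets it merge with the determinant,
   giving one normalizing factor per coordinate. *)
rewrite -[X in (2 * pi) ^+ X]card_ord -prodr_const -big_split /=.
have -> : Num.sqrt (\prod_(i < k) (2 * pi * v 0 i)) =
    \prod_(i < k) Num.sqrt (2 * pi * v 0 i).
  apply: (big_rec2 (fun a b => Num.sqrt a = b)) => [|i a b _ <-].
    exact: sqrtr1.
  by rewrite sqrtrM// mulr_ge0 ?mulr_ge0 ?pi_ge0 ?ltW.
rewrite -prodfV -big_split; apply: eq_bigr => j _ /=.
have s0 : Num.sqrt (v 0 j) != 0 by rewrite gt_eqF// sqrtr_gt0.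
have -> : diag_mx v j j = v 0 j by rewrite mxE eqxx.
rewrite /normal_pdf (negbTE s0) /normal_peak /normal_fun.
rewrite sqr_sqrtr ?ltW// !mxE; congr (_ * _).
  by congr (Num.sqrt _)^-1; ring.
by congr expR; field; rewrite gt_eqF.
Qed.

(** * One-dimensional normal laws: first moment and mass of a half-line *)

Section normal_one_dim.
Context {R : realType}.
Implicit Types m s x : R.
Local Notation mu := (@lebesgue_measure R).

Lemma normal_peak_double s : normal_peak s = 2 * normal_peak (2 * s).
Proof.
rewrite /normal_peak (_ : (2 * s) ^+ 2 * pi *+ 2 = 2 ^+ 2 * (s ^+ 2 * pi *+ 2)).
  by rewrite sqrtrM ?sqr_ge0// sqrtr_sqr ger0_norm// invfM mulVKf.
by ring.
Qed.

(* The factor |x - m| is absorbed by doubling the standard deviation. *)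
Lemma normr_normal_pdf_le m s x : 0 < s ->
  `|x - m| * normal_pdf m s x <= 2 * s * normal_pdf m (2 * s) x.
Proof.
move=> s0; rewrite !normal_pdfE ?mulf_neq0 ?gt_eqF//.
rewrite (normal_peak_double s) !mulrA [_ * 2]mulrC -!mulrA ler_pM2l//.
rewrite [leRHS]mulrCA [leLHS]mulrCA ler_wpM2l ?normal_peak_ge0//.
rewrite /normal_fun.
set z := x - m.
(* The exponents differ by 1/2 - 1/8 = 3/8 times u^2, where u = [|z| / s], so the claim reduces to u
   <= exp(3 u^2 / 8). *)
have -> : - z ^+ 2 / ((2 * s) ^+ 2 *+ 2) =
    3 / 8 * (`|z| / s) ^+ 2 + - z ^+ 2 / (s ^+ 2 *+ 2).
  by rewrite expr_div_n real_normK ?num_real//; field; rewrite gt_eqF.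
rewrite expRD mulrA ler_wpM2r ?expR_ge0//.
rewrite mulrC -ler_pdivrMr//; apply: le_trans (expR_ge1Dx _).
(* The quadratic 1 + 3 u^2 / 8 - u is smallest at u = 4/3, where it equals 1/3. *)
by have := sqr_ge0 (`|z| / s - 4 / 3); rewrite sqrrB; lra.
Qed.

Lemma normal_first_moment_le m s : 0 < s ->
  (\int[mu]_x (`|x - m| * normal_pdf m s x)%:E <= (2 * s)%:E)%E.
Proof.
move=> s0.
apply: (@le_trans _ _ (\int[mu]_x ((2 * s)%:E * (normal_pdf m (2 * s) x)%:E))%E).
  apply: ge0_le_integral => //.
  - by move=> x _; rewrite lee_fin mulr_ge0 ?normal_pdf_ge0.
  - apply/measurable_EFinP/measurable_funM; last exact: measurable_normal_pdf.
    by apply: measurableT_comp => //; exact: measurable_funB.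
  - apply/measurable_EFinP/measurable_funM => //; exact: measurable_normal_pdf.
  - by move=> x _; rewrite -EFinM lee_fin normr_normal_pdf_le.
rewrite ge0_integralZl//.
- by rewrite integral_normal_pdf mule1.
- by apply/measurable_EFinP; exact: measurable_normal_pdf.
- by move=> x _; rewrite lee_fin normal_pdf_ge0.
- by rewrite lee_fin mulr_ge0// ltW.
Qed.

(** The substitution [x - m] has derivative 1. Centering lets laws with different means be compared
    as two half-lines under a single law. *)
Lemma normal_prob_itvNy_center m s b : s != 0 ->
  normal_prob m s `]-oo, b] = normal_prob 0 s `]-oo, b - m].
Proof.
move=> s0; rewrite /normal_prob.
pose F x : R := x - m.
have F'E : F^`()%classic = cst 1.
  apply/funext => x; rewrite /F derive1E deriveB// derive_id derive_cst.
  by rewrite subr0.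
rewrite -/(F b) (@increasing_ge0_integration_by_substitutionNy _ F).
- apply: eq_integral => x _; rewrite F'E /= mulr1 /F.
  by rewrite !normal_pdfE// normal_fun_center.
- by move=> x y _ _ xy; rewrite ltrD2r.
- by rewrite F'E => x _; exact: cvg_cst.
- by rewrite F'E; exact: is_cvg_cst.
- by rewrite F'E; exact: cvg_cst.
- split; first by move=> x _; exact: derivableB.
  apply: cvg_at_left_filter; apply: cvgB; [exact: cvg_id|exact: cvg_cst].
- exact: cvg_addrr_Ny.
- by apply: continuous_subspaceT; exact: continuous_normal_pdf.
- by move=> x _; exact: normal_pdf_ge0.
Qed.

Lemma normal_prob_itvNy0_gap m m' s : 0 < s -> 0 <= m <= 1 -> 0 <= m' <= 1 ->
  m <= m' ->
  (((m' - m) * (normal_peak s * expR (- (s ^+ 2 *+ 2)^-1)))%:E <=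
   normal_prob m s `]-oo, 0%R] - normal_prob m' s `]-oo, 0%R])%E.
Proof.
move=> s0 /andP[m0 m1] /andP[m'0 m'1] mm'.
have sN0 : s != 0 by rewrite gt_eqF.
rewrite (normal_prob_itvNy_center m) ?(normal_prob_itvNy_center m')// !sub0r.
have -> : `]-oo, - m]%classic = `]-oo, (- m')] `|` `](- m'), (- m)] :> set R.
  by rewrite -itv_bndbnd_setU// ?bnd_simp// lerN2.
rewrite measureU//; last first.
  apply/seteqP; split => // x [] /=; rewrite !in_itv/= => xm /andP[].
  by rewrite ltNge xm.
rewrite addeAC subee ?fin_num_measure// add0e.
(* [c] is the centered density at distance 1 from its mean, hence its minimum on [-1, 1]. *)
set c := normal_peak s * _.
rewrite (_ : (_ * c)%:E = \int[mu]_(x in `](- m')%R, (- m)%R]) (cst c%:E x))%E; last first.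
  rewrite integral_cst//= lebesgue_measure_itv/= lte_fin ltrN2.
  case: ltP => [_|m'm].
    by rewrite -EFinD -EFinM opprK mulrC addrC.
  (* Equal means: the interval is empty and both sides vanish. *)
  by rewrite (le_anti (introT andP (conj mm' m'm))) subrr mul0r mule0.
apply: ge0_le_integral => //.
- by move=> x _; rewrite lee_fin mulr_ge0 ?normal_peak_ge0 ?expR_ge0.
- by apply/measurable_funTS/measurable_EFinP; exact: measurable_normal_pdf.
- move=> x; rewrite /= in_itv/= => /andP[xm' xm].
  rewrite lee_fin normal_pdfE// ler_wpM2l ?normal_peak_ge0//.
  rewrite ler_expR subr0 mulNr lerN2 ler_piMl//.
    by rewrite invr_ge0 mulrn_wge0// sqr_ge0.
  rewrite -real_normK ?num_real// exprn_ile1//.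
  by rewrite ler_norml; lra.
Qed.

Lemma normal_prob_itvNy0_dist m m' s : 0 < s -> 0 <= m <= 1 -> 0 <= m' <= 1 ->
  ((`|m - m'| * (normal_peak s * expR (- (s ^+ 2 *+ 2)^-1)))%:E <=
   `|normal_prob m s `]-oo, 0%R] - normal_prob m' s `]-oo, 0%R]|)%E.
Proof.
move=> s0 hm hm'; have [mm'|/ltW m'm] := leP m m'.
  rewrite distrC ger0_norm ?subr_ge0//.
  exact: le_trans (normal_prob_itvNy0_gap s0 hm hm' mm') (lee_abs _).
rewrite ger0_norm ?subr_ge0//.
apply: le_trans (normal_prob_itvNy0_gap s0 hm' hm m'm) _.
(* Finiteness is what allows the opposite of a difference of extended reals to be the swapped
   difference. *)
have : normal_prob m' s `]-oo, 0%R] \is a fin_num by rewrite fin_num_measure.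
move: (normal_prob m s _) (normal_prob m' s _) => a b bfin.
by rewrite -[leRHS]abseN fin_num_oppeB// addeC lee_abs.
Qed.

End normal_one_dim.

(** * Diagonal Gaussians: marginals, likelihood ratio and the bound on KL *)

Section mvnormal_diag.
Context {R : realType} (k : nat) (Sigma : 'M[R]_k).
Hypotheses (Sdiag : is_diag_mx Sigma) (S0 : forall j, 0 < Sigma j j).
Implicit Types mu : 'rV[R]_k.
Local Notation sd j := (Num.sqrt (Sigma j j)).

Let sd_gt0 j : 0 < sd j. Proof. by rewrite sqrtr_gt0. Qed.

Lemma mvnormal_pdf_ge0 mu y : 0 <= mvnormal_pdf mu Sigma y.
Proof. by rewrite mvnormal_pdf_diag// prodr_ge0// => j _; rewrite normal_pdf_ge0. Qed.

Lemma measurable_mvnormal_pdf mu : measurable_fun setT (mvnormal_pdf mu Sigma).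
Proof.
rewrite (_ : mvnormal_pdf mu Sigma = fun y : 'Rn[R]_k =>
    \prod_(j < k) normal_pdf (mu 0 j) (sd j) (tnth y j)); last first.
  by apply/funext => y; exact: mvnormal_pdf_diag.
apply: measurable_prod => j _.
exact: measurableT_comp (measurable_normal_pdf _ _) (@measurable_tnth _ _ _ j).
Qed.

(** Marginalization: the integrand is a product over coordinates, and every factor other than the
    [j]-th is a normal density, of integral 1. *)
Lemma integral_mvnormal_coord mu (P : probability 'Rn[R]_k R) j (g : R -> R) :
  is_mvnormal mu Sigma P -> measurable_fun setT g -> (forall x, 0 <= g x) ->
  (\int[P]_y (g (tnth y j))%:E =
   \int[lebesgue_measure]_x (g x * normal_pdf (mu 0 j) (sd j) x)%:E)%E.
Proof.
move=> hP mg g0.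
have mgj : measurable_fun setT (fun y : 'Rn[R]_k => (g (tnth y j))%:E : \bar R).
  apply/measurable_EFinP.
  exact: measurableT_comp mg (@measurable_tnth _ _ _ j).
rewrite (integral_density (measurable_mvnormal_pdf mu) (mvnormal_pdf_ge0 mu) hP)//;
  last by move=> y; rewrite lee_fin.
pose f i x := (if i == j then g x else 1) * normal_pdf (mu 0 i) (sd i) x.
transitivity (\int[lebesgue_tuple R k]_y (\prod_(i < k) f i (tnth y i))%:E)%E.
  apply: eq_integral => y _; rewrite mvnormal_pdf_diag// -EFinM big_split /=.
  by congr (_ * _)%:E; rewrite -big_mkcond big_pred1_eq.
rewrite integral_lebesgue_tuple_prod; last 2 first.
- move=> i; apply: measurable_funM; last exact: measurable_normal_pdf.
  by case: eqP => // _.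
- by move=> i x; rewrite mulr_ge0 ?normal_pdf_ge0//; case: eqP.
rewrite (bigD1 j)//= big1 ?mule1; last first.
  move=> i /negbTE ij; rewrite -[RHS](integral_normal_pdf (mu 0 i) (sd i)).
  by apply: eq_integral => x _; rewrite /f ij mul1r.
by apply: eq_integral => x _; rewrite /f eqxx.
Qed.

Lemma measurable_halfspace j : measurable [set y : 'Rn[R]_k | tnth y j <= 0].
Proof.
rewrite [X in measurable X](_ : _ = (@tnth _ _)^~ j @^-1` `]-oo, 0%R]); last first.
  by apply/seteqP; split => y /=; rewrite in_itv.
by rewrite -[X in measurable X]setTI; apply: measurable_tnth.
Qed.

(** The half-space is a cylinder over coordinate [j], so its mass depends only on that marginal. *)
Lemma mvnormal_halfspace mu (P : probability 'Rn[R]_k R) j :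
  is_mvnormal mu Sigma P ->
  P [set y | tnth y j <= 0] = normal_prob (mu 0 j) (sd j) `]-oo, 0%R].
Proof.
move=> hP.
rewrite -[in LHS](setIT [set y | tnth y j <= 0]) -integral_indic//; last first.
  exact: measurable_halfspace.
transitivity (\int[P]_y (\1_(`]-oo, 0%R]%classic : set R) (tnth y j))%:E)%E.
  apply: eq_integral => y _.
  by rewrite !indicE; do 3 congr (_ _); apply/idP/idP; rewrite !inE /= in_itv.
rewrite (integral_mvnormal_coord j hP)//.
rewrite /normal_prob [RHS]integral_mkcond; apply: eq_integral => x _.
by rewrite patchE indicE; case: ifPn; rewrite ?mul1r ?mul0r.
Qed.

Variables (mu mu' : 'rV[R]_k).
Local Notation D j := (mu 0 j - mu' 0 j).

(** The log-likelihood ratio of N([mu], [Sigma]) to N([mu'], [Sigma]): the difference of squares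
    (y_j - mu'_j)^2 - (y_j - mu_j)^2, expanded around [mu] because KL integrates against [P]. *)
Definition mvnormal_llr (y : 'Rn[R]_k) : R :=
  \sum_j D j * (2 * (tnth y j - mu 0 j) + D j) / (2 * Sigma j j).

(** The covariance is shared, so the normalizing factors agree and only the exponents differ. *)
Lemma mvnormal_pdf_ratio y : mvnormal_pdf mu Sigma y =
  expR (mvnormal_llr y) * mvnormal_pdf mu' Sigma y.
Proof.
rewrite !mvnormal_pdf_diag// expR_sum -big_split; apply: eq_bigr => j _ /=.
rewrite !normal_pdfE ?gt_eqF// mulrCA; congr (_ * _).
rewrite /normal_fun -expRD sqr_sqrtr ?ltW//; congr expR.
by field; rewrite gt_eqF.
Qed.

Lemma measurable_mvnormal_llr : measurable_fun setT mvnormal_llr.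
Proof.
apply: measurable_sum => j; apply: measurable_funM => //.
apply: measurable_funM => //; apply: measurable_funD => //.
apply: measurable_funM => //; apply: measurable_funB => //.
exact: measurable_tnth.
Qed.

Variables (P Q : probability 'Rn[R]_k R).
Hypotheses (hP : is_mvnormal mu Sigma P) (hQ : is_mvnormal mu' Sigma Q).

Let lr (y : 'Rn[R]_k) : \bar R := (expR (mvnormal_llr y))%:E.

Let measurable_lr : measurable_fun setT lr.
Proof.
by apply/measurable_EFinP; exact: measurableT_comp measurable_mvnormal_llr.
Qed.

(** An explicit density of [P] with respect to [Q]; it yields absolute continuity and identifies the
    Radon-Nikodym derivative. *)
Lemma mvnormal_density_ratio A : measurable A ->
  P A = (\int[Q]_(y in A) (expR (mvnormal_llr y))%:E)%E.
Proof.
move=> mA; rewrite integral_mkcond.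
rewrite (integral_density (measurable_mvnormal_pdf mu') (mvnormal_pdf_ge0 mu') hQ).
- rewrite hP// [LHS]integral_mkcond; apply: eq_integral => y _.
  rewrite !patchE; case: ifPn => _; last by rewrite mul0e.
  by rewrite -EFinM -mvnormal_pdf_ratio.
- by apply/(measurable_restrictT _ mA)/measurable_funTS.
- by move=> y; rewrite patchE; case: ifPn => // _; rewrite lee_fin expR_ge0.
Qed.

Lemma mvnormal_dominates : P `<< Q.
Proof.
apply/null_content_dominatesP => A mA QA0.
rewrite mvnormal_density_ratio// null_set_integral//.
exact: measurable_funTS.
Qed.

Lemma KL_mvnormal_le : (KL P Q <=
  (\sum_j `|D j| / (2 * Sigma j j) * (4 * sd j + `|D j|))%:E)%E.
Proof.
have PQ := mvnormal_dominates.
rewrite /KL asboolT//; set rn := Radon_Nikodym _ _.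
have mrn : measurable_fun setT rn.
  by apply: (@measurable_int _ _ _ Q); exact: Radon_Nikodym_integrable.
have mlnrn : measurable_fun setT (fun x => (ln (fine (rn x)))%:E : \bar R).
  apply/measurable_EFinP; apply: measurableT_comp; first exact: measurable_ln.
  exact: measurableT_comp mrn.
(* Both functions integrate to [P A] over every measurable [A], so they agree outside a [Q]-null
   set. *)
have rnQ : ae_eq Q setT rn lr.
  apply: integral_ae_eq => //; first exact: Radon_Nikodym_integrable.
  move=> A _ mA; rewrite /rn -Radon_Nikodym_integral//.
  exact: mvnormal_density_ratio.
(* KL integrates against [P]; absolute continuity makes the exceptional set [P]-null as well. *)
have rnP : ae_eq P setT rn lr.
  have [N [mN QN0 subN]] := rnQ; exists N; split => //.
  by move/null_content_dominatesP : PQ; exact.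
pose b j (y : 'Rn[R]_k) : \bar R :=
  (`|D j| / (2 * Sigma j j) * (2 * `|tnth y j - mu 0 j| + `|D j|))%:E.
have c0 j : 0 <= `|D j| / (2 * Sigma j j).
  by rewrite divr_ge0// mulr_ge0// ltW.
have mb j : measurable_fun setT (b j).
  apply/measurable_EFinP/measurable_funM => //; apply: measurable_funD => //.
  apply: measurable_funM => //; apply: measurableT_comp => //.
  by apply: measurable_funB => //; exact: measurable_tnth.
have b0 j y : (0 <= b j y)%E by rewrite lee_fin mulr_ge0// addr_ge0// mulr_ge0.
(* With absolute values all integrands are nonnegative, and the triangle inequality bounds the
   log-ratio almost everywhere by the sum of the [b j]. *)
apply: le_trans (lee_abs _) _.
apply: le_trans (le_abse_integral _ _ mlnrn) _ => //.
apply: (@le_trans _ _ (\int[P]_y \sum_j b j y)%E).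
  apply: ae_ge0_le_integral => //.
  - exact: measurableT_comp.
  - by move=> y _; exact: sume_ge0.
  - exact: emeasurable_sum.
  have [N [mN PN0 subN]] := rnP; exists N; split => //.
  apply: subset_trans subN; apply: subsetC => y /= rny _.
  rewrite rny//= expRK sumEFin lee_fin (le_trans (ler_norm_sum _ _ _))//.
  apply: ler_sum => j _; have S20 : 0 < 2 * Sigma j j by rewrite mulr_gt0.
  rewrite normrM (normrM (D j)) normfV (gtr0_norm S20) mulrAC ler_wpM2l//.
  by rewrite (le_trans (ler_normD _ _))// normrM ger0_norm.
rewrite ge0_integral_sum// -sumEFin; apply: lee_sum => j _.
set c : R := `|D j| / _.
have hc : 0 <= c := c0 j.
pose m : R := mu 0 j; pose g (x : R) : R := c * (2 * `|x - m| + `|D j|).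
have mabs : measurable_fun setT (fun x : R => `|x - m|).
  by apply: measurableT_comp => //; exact: measurable_funB.
have mpdf := measurable_normal_pdf m (sd j).
rewrite (integral_mvnormal_coord (g := g) j hP); last 2 first.
- by apply: measurable_funM => //; apply: measurable_funD => //; exact: measurable_funM.
- by move=> x; rewrite mulr_ge0// addr_ge0// mulr_ge0.
have -> : (\int[lebesgue_measure]_x (g x * normal_pdf m (sd j) x)%:E =
    \int[lebesgue_measure]_x ((c * 2)%:E * (`|x - m| * normal_pdf m (sd j) x)%:E +
      (c * `|D j|)%:E * (normal_pdf m (sd j) x)%:E))%E.
  by apply: eq_integral => x _; rewrite -!EFinM -EFinD; congr EFin; rewrite /g; ring.
rewrite ge0_integralD//; last 4 first.
- by move=> x _; apply: mule_ge0; rewrite lee_fin mulr_ge0// normal_pdf_ge0.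
- apply: emeasurable_funM => //; apply/(@measurable_EFinP _ (measurableTypeR R)).
  by apply: measurable_funM; [exact: mabs | exact: mpdf].
- move=> x _; apply: mule_ge0; rewrite lee_fin; first exact: mulr_ge0.
  exact: normal_pdf_ge0.
- apply: emeasurable_funM => //; apply/(@measurable_EFinP _ (measurableTypeR R)).
  exact: mpdf.
rewrite !ge0_integralZl//.
(* The 4 is the factor 2 in the log-ratio times the 2 of the first moment bound. *)
- rewrite integral_normal_pdf mule1 -(_ : (c * 2 * (2 * sd j))%:E + (c * `|D j|)%:E =
    (c * (4 * sd j + `|D j|))%:E)%E; last by rewrite -EFinD; congr EFin; ring.
  apply: leeD2r; rewrite (EFinM (c * 2)); apply: lee_wpmul2l.
    by rewrite lee_fin mulr_ge0.
  exact: normal_first_moment_le.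
- by apply/(@measurable_EFinP _ (measurableTypeR R)); exact: mpdf.
- by move=> x _; rewrite lee_fin normal_pdf_ge0.
- by rewrite lee_fin mulr_ge0.
- apply/(@measurable_EFinP _ (measurableTypeR R)).
  by apply: measurable_funM; [exact: mabs | exact: mpdf].
- by move=> x _; rewrite lee_fin mulr_ge0// normal_pdf_ge0.
- by rewrite lee_fin mulr_ge0.
Qed.

End mvnormal_diag.

(** * From a lower bound on KL to a distinguishing half-space *)

Lemma halfspace_inj (R : realType) (k : nat) :
  injective (fun j : 'I_k => [set y : 'Rn[R]_k | tnth y j <= 0]).
Proof.
move=> i j /seteqP[ij _]; apply/eqP/contraT => ji.
(* This point lies in the half-space of [i] and in no other. *)
pose y : 'Rn[R]_k := [tuple (if l == i then 0 else 1) | l < k].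
have /ij /= : tnth y i <= 0 by rewrite tnth_mktuple eqxx.
by rewrite tnth_mktuple eq_sym (negbTE ji) ler10.
Qed.

Lemma normal_peak_le (R : realType) (s t : R) : 0 < s -> s <= t ->
  normal_peak t <= normal_peak s.
Proof.
move=> s0 st; have t0 : 0 < t by exact: lt_le_trans st.
rewrite /normal_peak lef_pV2 ?posrE ?sqrtr_gt0 ?pmulrn_lgt0 ?mulr_gt0 ?pi_gt0 ?exprn_gt0//.
by rewrite ler_wsqrtr// lerMn2r/= ler_wpM2r ?pi_ge0// lerXn2r// nnegrE ltW.
Qed.

Lemma sqrtr_le (R : rcfType) (x t : R) : 0 <= t -> x <= t ^+ 2 -> Num.sqrt x <= t.
Proof. by move=> t0 xt; rewrite -(ger0_norm t0) -sqrtr_sqr ler_wsqrtr. Qed.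

(** By contraposition: if every mean gap is below the threshold, each summand of the KL bound is at
    most [gamma / k.+1%:R], so KL falls below [gamma]. *)
Lemma mean_gap_of_KL (R : realType) (k : nat) (Sigma : 'M[R]_k) (sigma v gamma : R)
    (mu mu' : 'rV[R]_k) (P Q : probability 'Rn[R]_k R) :
  is_diag_mx Sigma -> 0 < sigma -> 0 < v -> 0 < gamma ->
  (forall j, v <= Sigma j j <= sigma ^+ 2) ->
  (forall j, 0 <= mu 0 j <= 1) -> (forall j, 0 <= mu' 0 j <= 1) ->
  is_mvnormal mu Sigma P -> is_mvnormal mu' Sigma Q -> (gamma%:E <= KL P Q)%E ->
  exists j, 2 * v / (4 * sigma + 1) * (gamma / k.+1%:R) <= `|mu 0 j - mu' 0 j|.
Proof.
move=> Sdiag s0 v0 g0 hS hmu hmu' hP hQ.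
have S0 j : 0 < Sigma j j by have /andP[vS _] := hS j; exact: lt_le_trans vS.
move=> /le_trans/(_ (KL_mvnormal_le Sdiag S0 hP hQ)); rewrite lee_fin => gK.
apply/not_existsP => small; move: gK; apply/negP; rewrite -ltNge.
have k0 : 0 < k.+1%:R :> R by rewrite ltr0n.
(* Only [k] summands share [k.+1] portions, which makes the inequality strict, also for [k = 0]. *)
apply: (@le_lt_trans _ _ (\sum_(j < k) gamma / k.+1%:R)); last first.
  rewrite sumr_const card_ord -[ltLHS]mulr_natr mulrAC ltr_pdivrMr//.
  by rewrite ltr_pM2l// ltr_nat.
apply: ler_sum => j _; have /andP[vS Ss] := hS j.
move: (small j) => /negP; rewrite -ltNge => /ltW Dsmall.
have Dle1 : `|mu 0 j - mu' 0 j| <= 1.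
  by move: (hmu j) (hmu' j); rewrite ler_norml; lra.
have sds : Num.sqrt (Sigma j j) <= sigma.
  by apply: sqrtr_le => //; exact: ltW.
have s1 : 0 < 4 * sigma + 1 by lra.
(* The threshold is chosen so that its quotient by [2 * v], times the bound [4 * sigma + 1] on the
   second factor, is exactly [gamma / k.+1%:R]. *)
rewrite [leRHS](_ : _ = 2 * v / (4 * sigma + 1) * (gamma / k.+1%:R) / (2 * v) *
  (4 * sigma + 1)); last by field; rewrite !gt_eqF.
have S20 : 0 < 2 * Sigma j j by rewrite mulr_gt0.
apply: ler_pM.
- by rewrite divr_ge0// ltW.
- by rewrite addr_ge0// mulr_ge0// sqrtr_ge0.
- apply: ler_pM => //; first by rewrite invr_ge0 ltW.
  by rewrite lef_pV2 ?posrE ?mulr_gt0// ler_pM2l.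
- by apply: lerD => //; rewrite ler_pM2l.
Qed.

Theorem theorem7 (R : realType) (sigma : R) :
  1 < sigma ->
  exists (C : R -> R) (p : {poly {poly R}}),
  forall (k : nat) (Sigma : 'M[R]_k),
    is_diag_mx Sigma ->
    (forall j, 0 < Sigma j j <= sigma ^+ 2) ->
  exists2 E : R -> set (set 'Rn[R]_k),
    is_event_class E &
    forall gamma : R, 0 < gamma ->
    exists (n : nat) (xi : R),
      [/\ (E gamma #= `I_n)%card,
          0 < xi,
          Num.max xi^-1 n%:R <=
            C (min_variance (sigma ^+ 2) Sigma) * p.[k%:R%:P].[gamma^-1]
        & forall P Q : probability 'Rn[R]_k R,
            gaussian_class Sigma P -> gaussian_class Sigma Q ->
            (gamma%:E <= KL P Q)%E ->
            exists2 A, E gamma A & distinguishing xi P Q A].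
Proof.
move=> s1; have s0 : 0 < sigma by exact: lt_trans s1.
(* A floor for the centered density at distance 1, uniform over variances in [v, sigma^2]: the peak
   is smallest at [sigma], the exponential at [v]. *)
pose dens v := normal_peak sigma * expR (- (v *+ 2)^-1).
(* The constant of [mean_gap_of_KL] times the density floor. *)
pose kappa v := 2 * v / (4 * sigma + 1) * dens v.
have dens0 v : 0 < dens v by rewrite mulr_gt0 ?expR_gt0 ?normal_peak_gt0 ?gt_eqF.
have sp : 0 < 4 * sigma + 1 by rewrite addr_gt0// mulr_gt0.
have kappa0 v : 0 < v -> 0 < kappa v.
  by move=> v0; rewrite mulr_gt0// divr_gt0// mulr_gt0.
(* The outer variable stands for [k], the inner one for 1/gamma. The summand (k + 1)/gamma times
   1/kappa is 1/xi, the summand [k] counts the events, and [C] dominates both 1/kappa and 1. *)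
exists (fun v => 1 + (kappa v)^-1), (('X + 1) * 'X%:P + 'X).
move=> k Sigma Sdiag hS; set v := min_variance _ _.
have v0 : 0 < v.
  rewrite /v /min_variance; elim/big_ind: _ => [|x y x0 y0|j _].
  - by rewrite exprn_gt0.
  - by rewrite lt_min x0.
  - by case/andP: (hS j).
have vS j : v <= Sigma j j <= sigma ^+ 2.
  by rewrite bigmin_le/=; case/andP: (hS j).
exists (fun=> range (fun j : 'I_k => [set y : 'Rn[R]_k | tnth y j <= 0])).
  by move=> gamma _ _ [j _ <-]; exact: measurable_halfspace.
move=> gamma g0; exists k, (kappa v * (gamma / k.+1%:R)).
have gk0 : 0 < gamma / k.+1%:R by rewrite divr_gt0// ltr0n.
split.
- apply: card_eq_trans (card_esym card_II).
  by apply: inj_card_eq => i j _ _; exact: halfspace_inj.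
- by rewrite mulr_gt0 ?kappa0.
- have -> : (('X + 1) * 'X%:P + 'X : {poly {poly R}}).[k%:R%:P].[gamma^-1] =
      (k%:R + 1) / gamma + k%:R by rewrite !hornerE.
  rewrite invfM invf_div -natr1.
  have K0 : 0 <= (kappa v)^-1 by rewrite invr_ge0 ltW ?kappa0.
  have G0 : 0 <= (k%:R + 1) / gamma by rewrite divr_ge0 ?addr_ge0 ?ler0n ?ltW.
  have k0 : 0 <= k%:R :> R by rewrite ler0n.
  by rewrite ge_max; apply/andP; split; nra.
move=> P Q [mu hmu hP] [mu' hmu' hQ] gKL.
have S0 j : 0 < Sigma j j by case/andP: (hS j).
have [j Dj] := mean_gap_of_KL Sdiag s0 v0 g0 vS hmu hmu' hP hQ gKL.
exists [set y | tnth y j <= 0]; first by exists j.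
rewrite /distinguishing (mvnormal_halfspace Sdiag S0 j hP).
rewrite (mvnormal_halfspace Sdiag S0 j hQ).
have sd0 : 0 < Num.sqrt (Sigma j j) by rewrite sqrtr_gt0.
apply: le_trans (normal_prob_itvNy0_dist sd0 (hmu j) (hmu' j)).
have /andP[vSj Ss] := vS j.
rewrite lee_fin sqr_sqrtr; last exact: ltW.
(* Regroups [xi] as mean gap threshold times density floor, to be compared factor by factor. *)
rewrite /kappa mulrAC; apply: ler_pM => //.
- by rewrite ltW// mulr_gt0// divr_gt0// mulr_gt0.
- exact: ltW.
apply: ler_pM; rewrite ?expR_ge0 ?normal_peak_ge0//.
  apply: normal_peak_le => //.
  by apply: sqrtr_le => //; exact: ltW.
by rewrite ler_expR lerN2 lef_pV2 ?posrE ?pmulrn_lgt0// lerMn2r.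
Qed.
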